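(* Let $r$ be a positive integer, and define $a_r(n)$ for integers $n\ge 0$ by \[ \sum_{n=0}^{\infty} a_r(n) q^n = \prod_{n=1}^{\infty} \frac{1}{(1-q^n)(1-q^{rn})}. \] Let \[ c_r := \frac{135}{\pi\sqrt{1+r^{-1}}} + \pi\sqrt{\frac{(1+r)^3}{r}}. \] Then, as $n\to\infty$, \[ \log\left(a_r(n)\right) \sim \pi\sqrt{\frac{2n(1+r^{-1})}{3}} - \frac{5}{4}\log(n) + \log\left(\frac{2\sqrt{3r}\,(1+r^{-1})^{\frac{3}{4}}}{24^{\frac{5}{4}}}\right) - \frac{c_r}{24\sqrt{6n}}. \]
   Context: Here $q$ is a formal variable (equivalently a complex number with $|q|<1$), so $a_r(n)$ is the number of two-colored partitions of $n$ in which a part may carry the second color only if it is divisible by $r$. The symbol $f(n)\sim g(n)$ means $\lim_{n\to\infty} f(n)/g(n) = 1$. *)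

(* Defs.v *)
From HB Require Import structures.
From mathcomp Require Import all_boot all_order all_algebra.
From mathcomp Require Import all_classical all_reals all_analysis.
Set Implicit Arguments.
Unset Strict Implicit.
Unset Printing Implicit Defensive.
Import Order.TTheory GRing.Theory Num.Theory.
Import numFieldNormedType.Exports.
Local Open Scope classical_set_scope.
Local Open Scope ring_scope.

(** A formal power series [\sum_n f_n q^n] over a field [K] is represented by
    its coefficient sequence [f : nat -> K]. *)
Section FormalPowerSeries.
Variable K : fieldType.
Implicit Types (f g : nat -> K) (p : {poly K}).

Definition fps1 : nat -> K := fun n => (n == 0%N)%:R.

Definition fpsM f g : nat -> K := fun n => \sum_(i < n.+1) f i * g (n - i)%N.

Definition fps_of_poly p : nat -> K := fun n => p`_n.

(** First [n.+1] coefficients of [1 / f], obtained by solving [f * g = 1]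
    degree by degree; meaningful when [f 0 != 0] (see [fpsMV]). *)
Fixpoint fps_inv_seq f n : seq K :=
  if n is m.+1 then
    let s := fps_inv_seq f m in
    rcons s (- (f 0%N)^-1 * \sum_(i < m.+1) f i.+1 * s`_(m - i))
  else [:: (f 0%N)^-1].

Definition fps_inv f : nat -> K := fun n => (fps_inv_seq f n)`_n.

(** [F 1 * F 2 * ... * F N] *)
Fixpoint fps_prod (F : nat -> nat -> K) N : nat -> K :=
  if N is M.+1 then fpsM (fps_prod F M) (F M.+1) else fps1.

(** [g] is the infinite product [F 1 * F 2 * ...] for the [q]-adic topology:
    each coefficient of the partial products is eventually that of [g]. *)
Definition fps_is_infprod (F : nat -> nat -> K) g : Prop :=
  forall n, exists N0, forall N, (N0 <= N)%N -> fps_prod F N n = g n.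

Lemma size_fps_inv_seq f n : size (fps_inv_seq f n) = n.+1.
Proof. by elim: n => //= n IHn; rewrite size_rcons IHn. Qed.

Lemma nth_fps_inv_seq f n i : (i <= n)%N -> (fps_inv_seq f n)`_i = fps_inv f i.
Proof.
elim: n => [|n IHn]; first by rewrite leqn0 => /eqP->.
rewrite leq_eqVlt => /predU1P[->//|]; rewrite ltnS => le_in.
by rewrite /= nth_rcons size_fps_inv_seq ltnS le_in IHn.
Qed.

Lemma fps_invS f n : fps_inv f n.+1 =
  - (f 0%N)^-1 * \sum_(i < n.+1) f i.+1 * fps_inv f (n - i)%N.
Proof.
rewrite {1}/fps_inv /= nth_rcons size_fps_inv_seq ltnn eqxx.
by congr (_ * _); apply: eq_bigr => i _; rewrite nth_fps_inv_seq ?leq_subr.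
Qed.

Lemma fpsMV f : f 0%N != 0 -> fpsM f (fps_inv f) =1 fps1.
Proof.
move=> f0 [|n]; rewrite /fpsM big_ord_recl.
  by rewrite big_ord0 addr0 divff.
rewrite subn0 fps_invS mulrA mulrN divff // mulN1r /fps1 /=.
apply/eqP; rewrite addrC subr_eq0; apply/eqP; apply: eq_bigr => i _.
by rewrite /= /bump /= add1n subSS.
Qed.

Lemma fps_infprod_exists (F : nat -> nat -> K) :
  (forall k i, (i < k)%N -> F k i = fps1 i) -> {g | fps_is_infprod F g}.
Proof.
move=> F1; exists (fun n => fps_prod F n n) => n; exists n.
elim=> [|N IHN]; first by rewrite leqn0 => /eqP->.
rewrite leq_eqVlt => /predU1P[->//|]; rewrite ltnS => le_nN.
rewrite -IHN //= /fpsM big_ord_recr /= subnn F1 // mulr1 big1 ?add0r // => i _.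
rewrite F1; last by rewrite ltnS (leq_trans (leq_subr _ _)).
by rewrite /fps1 subn_eq0 leqNgt ltn_ord mulr0.
Qed.

Definition two_color_factor (r k : nat) : nat -> K :=
  fps_inv (fps_of_poly ((1 - 'X^k) * (1 - 'X^(r * k)))).

Definition two_color_gf (r : nat) (a : nat -> K) : Prop :=
  fps_is_infprod (two_color_factor r) a.

Lemma two_color_gf_exists r : (0 < r)%N -> {a | two_color_gf r a}.
Proof.
move=> r0; apply: fps_infprod_exists => k i lt_ik.
have k0 : (0 < k)%N by apply: leq_trans lt_ik.
have le_krk : (k <= r * k)%N by rewrite leq_pmull.
set p := (1 - 'X^k) * (1 - 'X^(r * k)) : {poly K}.
have pE j : (j < k)%N -> p`_j = fps1 j.
  move=> lt_jk; rewrite /p mulrBl mul1r coefB coefXnM lt_jk subr0.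
  rewrite coefB coef1 coefXn /fps1.
  by rewrite (ltn_eqF (leq_trans lt_jk le_krk)) subr0.
rewrite /two_color_factor -/p; case: i lt_ik => [|i] lt_ik.
  by rewrite /fps_inv /= /fps_of_poly pE // invr1.
rewrite fps_invS big1 ?mulr0 // => j _; rewrite /fps_of_poly pE ?mul0r //.
exact: leq_ltn_trans (ltn_ord j) lt_ik.
Qed.

End FormalPowerSeries.

Section Asymptotics.
Variable R : realType.

Definition asymp_equiv (f g : nat -> R) : Prop :=
  (f n / g n) @[n --> \oo] --> (1 : R).

Definition c_ (r : nat) : R :=
  135 / (pi * Num.sqrt (1 + r%:R^-1))
  + pi * Num.sqrt ((1 + r%:R) ^+ 3 / r%:R).

End Asymptotics.

(* Main.v *)
Require Import Defs.
From HB Require Import structures.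
From mathcomp Require Import all_boot all_order all_algebra.
From mathcomp Require Import all_classical all_reals all_analysis.
From mathcomp Require Import zify ring lra.
Import Order.TTheory GRing.Theory Num.Theory.
Import numFieldNormedType.Exports.
Local Open Scope classical_set_scope.
Local Open Scope ring_scope.
Set Implicit Arguments.
Unset Strict Implicit.
Unset Printing Implicit Defensive.

(** Since [~] compares logarithms, only the leading term matters: it suffices
    that [ln (a n) / sqrt n] tends to [C = pi * sqrt (2 (1 + 1/r) / 3)].  As in
    Erdos's elementary treatment of the partition function, logarithmic
    differentiation of the product gives
      [n a(n) = \sum_(k, m >= 1) (k a(n - k m) + r k a(n - r k m))].
    Feeding the ansatz [exp (c sqrt n)] into the right-hand side and using
    [sqrt (n - j) ~ sqrt n - j / (2 sqrt n)] and
    [\sum_k k exp (- k x) ~ x^-2] multiplies it by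
    [n * 4 (1 + 1/r) / c^2 * \sum_m m^-2], which equals [n] exactly for [c = C]
    because [\sum_m m^-2 = pi^2 / 6].  So [a n <= exp (C sqrt n)], and
    [a n >= delta * exp (c sqrt n)] for every [c < C], by induction.  The value
    of [\sum_m m^-2] comes from [1/x^2 <= 1/sin^2 x <= 1 + 1/x^2] and the closed
    form of [\sum_k 1 / sin^2 (k pi / 2^n)], itself a consequence of
    [1/sin^2 (x/2) + 1/cos^2 (x/2) = 4/sin^2 x]. *)

(** * Logarithmic derivative of the product *)

Section FpsTheory.
Variable K : fieldType.
Implicit Types f g h : nat -> K.

(** Truncating both series to polynomials transfers the ring laws of [{poly K}] to [fpsM]. *)
Lemma fpsM_polyE m n f g : (n < m)%N ->
  fpsM f g n = ((\poly_(i < m) f i) * \poly_(i < m) g i)`_n.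
Proof.
move=> nm; rewrite coefM; apply: eq_bigr => i _; rewrite !coef_poly.
by rewrite !(leq_ltn_trans _ nm) ?leq_subr // -ltnS.
Qed.

Lemma eq_fpsM f f' g g' : f =1 f' -> g =1 g' -> fpsM f g =1 fpsM f' g'.
Proof. by move=> ff' gg' n; apply: eq_bigr => i _; rewrite ff' gg'. Qed.

Lemma fpsMC f g : fpsM f g =1 fpsM g f.
Proof. by move=> n; rewrite !(@fpsM_polyE n.+1) // mulrC. Qed.

Lemma fpsMA f g h : fpsM f (fpsM g h) =1 fpsM (fpsM f g) h.
Proof.
move=> n; rewrite [RHS](@fpsM_polyE n.+1) // (@fpsM_polyE n.+1) //.
transitivity ((\poly_(i < n.+1) f i * \poly_(i < n.+1) g i *
  \poly_(i < n.+1) h i)`_n).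
  rewrite -mulrA !coefM; apply: eq_bigr => i _; congr (_ * _).
  by rewrite coef_poly ltnS leq_subr (@fpsM_polyE n.+1) // ltnS leq_subr.
rewrite !coefM; apply: eq_bigr => i _; congr (_ * _).
by rewrite [RHS]coef_poly ltn_ord (@fpsM_polyE n.+1).
Qed.

Lemma fps1M f : fpsM (fps1 K) f =1 f.
Proof.
move=> n; rewrite /fpsM big_ord_recl subn0 /fps1 mul1r big1 ?addr0 // => i _.
by rewrite mul0r.
Qed.

Lemma fpsMDr f g h : fpsM f (fun n => g n + h n) =1 fun n => fpsM f g n + fpsM f h n.
Proof. by move=> n; rewrite -big_split; apply: eq_bigr => i _; rewrite mulrDr. Qed.

Lemma fpsMNr f g : fpsM f (fun n => - g n) =1 fun n => - fpsM f g n.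
Proof. by move=> n; rewrite /fpsM -sumrN; apply: eq_bigr => i _; rewrite mulrN. Qed.

(** The Euler operator [q d/dq]: a derivation that preserves degrees, so no index is shifted. *)
Definition fpsD f : nat -> K := fun n => n%:R * f n.

Lemma fpsD_M f g :
  fpsD (fpsM f g) =1 fun n => fpsM (fpsD f) g n + fpsM f (fpsD g) n.
Proof.
move=> n; rewrite /fpsD /fpsM mulr_sumr -big_split; apply: eq_bigr => i _ /=.
by rewrite -{1}(@subnKC i n) -1?ltnS // natrD; ring.
Qed.

(** The logarithmic derivative [q f' / f] of [f = 1 / (1 - q^k)]. *)
Definition geom_logder k : nat -> K := fun n => ((0 < n) && (k %| n))%N%:R * k%:R.

Lemma fpsM_1subXn_geom k : (0 < k)%N ->
  fpsM (fps_of_poly (1 - 'X^k)) (geom_logder k) =1 fun n => (n == k)%:R * k%:R.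
Proof.
move=> k0 n.
have -> : fpsM (fps_of_poly (1 - 'X^k)) (geom_logder k) n =
  geom_logder k n - (if (n < k)%N then 0 else geom_logder k (n - k)).
  rewrite (@fpsM_polyE n.+1) //.
  have -> : ((\poly_(i < n.+1) fps_of_poly (1 - 'X^k) i) *
             (\poly_(i < n.+1) geom_logder k i))`_n =
            ((1 - 'X^k) * (\poly_(i < n.+1) geom_logder k i))`_n.
    by rewrite !coefM; apply: eq_bigr => i _; rewrite [X in X * _]coef_poly ltn_ord.
  rewrite mulrBl mul1r coefB coefXnM !coef_poly ltnSn.
  by case: ifP => // _; rewrite ltnS leq_subr.
rewrite /geom_logder; case: (ltngtP n k) => [nk|nk|->] /=.
- have [->|n0] := posnP n; first by rewrite ?mulr0n ?mul0r ?subr0.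
  by rewrite gtnNdvd ?subr0.
- rewrite subn_gt0 nk (ltn_trans k0 nk) dvdn_subl ?dvdnn ?(ltnW nk) //.
  by rewrite subrr mul0r.
- by rewrite k0 dvdnn subnn mul0r subr0.
Qed.

Lemma fps_of_polyM (p q : {poly K}) :
  fps_of_poly (p * q) =1 fpsM (fps_of_poly p) (fps_of_poly q).
Proof. by move=> n; rewrite /fps_of_poly coefM. Qed.

Lemma fpsD_1subXn k : (0 < k)%N -> fpsD (fps_of_poly (1 - 'X^k)) =1
  fun n => - fpsM (fps_of_poly (1 - 'X^k)) (geom_logder k) n.
Proof.
move=> k0 n; rewrite fpsM_1subXn_geom // /fpsD /fps_of_poly coefB coef1 coefXn.
have [->|n0] := eqVneq n 0%N; first by rewrite mul0r eq_sym (gtn_eqF k0) mul0r oppr0.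
by rewrite sub0r mulrN mulrC; case: eqVneq => [->|]; rewrite ?mul0r.
Qed.

(** The factor is the inverse [g] of a polynomial [f] with [D f = - f L]. Differentiating [f g = 1]
    gives [f (D g) = f (g L)], and multiplying by [g] cancels [f]. *)
Lemma fpsD_two_color_factor r k : (0 < r)%N -> (0 < k)%N ->
  fpsD (two_color_factor K r k) =1 fpsM (two_color_factor K r k)
    (fun n => geom_logder k n + geom_logder (r * k) n).
Proof.
move=> r0 k0; have rk0 : (0 < r * k)%N by rewrite muln_gt0 r0.
rewrite /two_color_factor; set f := fps_of_poly _; set L := fun n : nat => _.
have Df : fpsD f =1 fun n => - fpsM f L n.
  move=> n; rewrite /f /fpsD fps_of_polyM -/(fpsD _ n) fpsD_M.
  rewrite (eq_fpsM (fpsD_1subXn k0) (frefl _)) fpsMC fpsMNr.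
  rewrite (eq_fpsM (frefl _) (fpsD_1subXn rk0)) fpsMNr -opprD; congr (- _).
  rewrite /L fpsMDr; congr (_ + _).
    by rewrite fpsMA; apply: eq_fpsM => // i; rewrite fps_of_polyM fpsMC.
  by rewrite fpsMA; apply: eq_fpsM => // i; rewrite fps_of_polyM.
have f0 : f 0%N != 0.
  rewrite /f /fps_of_poly coef0M !coefB coef1 !coefXn.
  by rewrite (ltn_eqF k0) (ltn_eqF rk0) !subr0 mulr1 oner_neq0.
have fg := fpsMV f0; set g := fps_inv f in fg *.
have Dfg n : fpsM f (fpsD g) n = fpsM f (fpsM g L) n.
  have : fpsD (fpsM f g) n = 0.
    by rewrite /fpsD fg /fps1; case: n => [|n]; rewrite ?mul0r ?mulr0.
  rewrite fpsD_M (eq_fpsM Df (frefl _)) fpsMC fpsMNr addrC => /eqP.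
  rewrite subr_eq0 => /eqP ->; rewrite fpsMC -!fpsMA.
  by apply: eq_fpsM => // i; rewrite fpsMC.
have cancel u n : fpsM g (fpsM f u) n = u n.
  by rewrite fpsMA -[RHS]fps1M; apply: eq_fpsM => // i; rewrite fpsMC fg.
by move=> n; rewrite -cancel -[RHS]cancel; apply: eq_fpsM.
Qed.

Lemma fpsD_two_color_prod r N : (0 < r)%N ->
  fpsD (fps_prod (two_color_factor K r) N) =1
  fpsM (fps_prod (two_color_factor K r) N)
    (fun n => \sum_(1 <= k < N.+1) (geom_logder k n + geom_logder (r * k) n)).
Proof.
move=> r0; elim: N => [|N IHN] n.
  rewrite /= fps1M big_geq // /fpsD /fps1.
  by case: n => [|n]; rewrite ?mul0r ?mulr0.
set F := fps_prod _ N in IHN *; set G := two_color_factor K r N.+1.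
rewrite /= -/F -/G fpsD_M.
rewrite (eq_fpsM IHN (frefl _)) (eq_fpsM (frefl _) (fpsD_two_color_factor r0 (ltn0Sn N))).
rewrite -/G -fpsMA (eq_fpsM (frefl F) (fpsMC _ G)) !fpsMA -fpsMDr.
by apply: eq_fpsM => // i; rewrite [RHS]big_nat_recr.
Qed.

(** * Recurrence for the coefficients *)

Lemma sum_dvdn d n (g : nat -> K) : (0 < d)%N ->
  \sum_(1 <= j < n.+1) (d %| j)%:R * g j =
  \sum_(1 <= m < n.+1) (if (d * m <= n)%N then g (d * m)%N else 0).
Proof.
move=> d0; rewrite -big_mkcond /= (eq_bigr (fun j => if (d %| j)%N then g j else 0)).
  rewrite -big_mkcond /=.
  rewrite -(big_map (fun m => (d * m)%N) (fun j => true && (j <= n)%N) g) /=.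
  rewrite -[LHS]big_filter -[RHS]big_filter; apply: perm_big; apply: uniq_perm.
  - by rewrite filter_uniq ?iota_uniq.
  - rewrite filter_uniq // map_inj_uniq ?iota_uniq // => x y /eqP.
    by rewrite eqn_pmul2l // => /eqP.
  move=> j; rewrite !mem_filter mem_index_iota; apply/idP/idP.
    case/and3P=> /dvdnP[m ->]; rewrite muln_gt0 ltnS => /andP[m0 _] jn.
    rewrite jn mulnC; apply/mapP; exists m => //.
    by rewrite mem_index_iota m0 ltnS (leq_trans _ jn) // leq_pmulr.
  case/andP=> jn /mapP[m]; rewrite mem_index_iota => /andP[m0 _] jE.
  by rewrite ltnS jn jE dvdn_mulr // muln_gt0 d0 m0.
by move=> j _; case: ifP; rewrite ?mul1r ?mul0r.
Qed.

Definition divisor_conv d (a : nat -> K) n :=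
  \sum_(1 <= m < n.+1) \sum_(1 <= k < n.+1)
    (if (d * k * m <= n)%N then (d * k)%:R * a (n - d * k * m)%N else 0).

Lemma two_color_rec r a n : (0 < r)%N -> two_color_gf r a ->
  n%:R * a n = divisor_conv 1 a n + divisor_conv r a n.
Proof.
move=> r0 a_gf.
(* One partial product that has stabilised in all degrees up to [n] replaces the infinite
   product. *)
have [N [nN FE]] : exists N, (n <= N)%N /\
    forall i, (i <= n)%N -> fps_prod (two_color_factor K r) N i = a i.
  have : forall m, exists N0, forall N, (N0 <= N)%N -> forall i, (i <= m)%N ->
      fps_prod (two_color_factor K r) N i = a i.
    elim=> [|m [N1 H1]].
      by have [N0 H0] := a_gf 0%N; exists N0 => N /H0 E i; rewrite leqn0 => /eqP->.
    have [N2 H2] := a_gf m.+1; exists (maxn N1 N2) => N.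
    rewrite geq_max => /andP[/H1 E1 /H2 E2] i.
    by rewrite leq_eqVlt => /predU1P[->//|]; rewrite ltnS => /E1.
  case/(_ n)=> N0 H; exists (maxn n N0); rewrite leq_maxl; split=> // i.
  by apply: H; rewrite leq_maxr.
have := fpsD_two_color_prod N r0 n; rewrite fpsMC /fpsD FE // => ->.
rewrite /fpsM big_ord_recl big1 ?mul0r ?add0r; last first.
  by move=> k _; rewrite /geom_logder /= !mul0r addr0.
have -> : \sum_(i < n) (\sum_(1 <= k < N.+1) (geom_logder k (lift ord0 i) +
      geom_logder (r * k) (lift ord0 i))) *
      fps_prod (two_color_factor K r) N (n - lift ord0 i) =
   \sum_(1 <= j < n.+1) \sum_(1 <= k < n.+1)
     ((k %| j)%:R * (k%:R * a (n - j)%N) + (r * k %| j)%:R * ((r * k)%:R * a (n - j)%N)).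
  rewrite big_add1 big_mkord; apply: eq_bigr => i _; rewrite lift0 FE ?leq_subr //.
  (* Factors with [k > n] drop out: neither [k] nor [r * k] divides a positive index at most [n]. *)
  rewrite (big_cat_nat (n := n.+1)) //= [X in _ + X]big_nat [X in _ + X]big1 ?addr0.
    rewrite mulr_suml; apply: eq_bigr => k _.
    by rewrite /geom_logder /= mulrDl -!mulrA.
  move=> k /andP[nk _]; have k0 : (0 < k)%N by apply: leq_trans nk.
  have ik : (i.+1 < k)%N by apply: leq_trans nk; rewrite ltnS.
  rewrite /geom_logder !gtnNdvd ?mul0r ?addr0 // (leq_trans ik) // leq_pmull //.
rewrite exchange_big /=.
under eq_bigr do rewrite big_split.
rewrite big_split /= /divisor_conv.
congr (_ + _); rewrite [RHS]exchange_big /= !big_nat; apply: eq_bigr => k /andP[k0 _].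
  by rewrite (sum_dvdn _ (fun j => k%:R * a (n - j)%N)) //; under [RHS]eq_bigr do rewrite mul1n.
by rewrite (sum_dvdn _ (fun j => (r * k)%:R * a (n - j)%N)) // muln_gt0 r0.
Qed.

End FpsTheory.

(** * The sum of inverse squares *)

Section Elementary.
Variable R : realType.
Implicit Types x y : R.

(** * Elementary inequalities from the mean value theorem *)

Lemma derive_ge0_le (f df : R -> R) (b : R) : 0 <= b ->
  (forall x, 0 <= x <= b -> is_derive x 1 f (df x)) ->
  (forall x, 0 <= x <= b -> 0 <= df x) -> f 0 <= f b.
Proof.
move=> b0 fdf df0.
have cf : {within `[0, b], continuous f}.
  apply: derivable_within_continuous => x; rewrite in_itv /= => xb.
  by have [] := fdf _ xb.
have fdf' x : x \in `]0, b[%R -> is_derive x 1 f (df x).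
  by rewrite in_itv /= => /andP[x0 xb]; apply: fdf; rewrite !ltW.
have [c + E] := MVT_segment b0 fdf' cf.
rewrite in_itv /= => cb; rewrite -subr_ge0 E subr0 mulr_ge0 //; exact: df0.
Qed.

Lemma sin_le x : 0 <= x -> sin x <= x.
Proof.
move=> x0; rewrite -subr_ge0.
have := @derive_ge0_le (fun y => y - sin y) (fun y => 1 - cos y) x x0.
rewrite sin0 subrr; apply => y _; by rewrite subr_ge0 cos_le1.
Qed.

Lemma le_tan x : 0 <= x < pi / 2 -> x <= tan x.
Proof.
move=> /andP[x0 xp]; rewrite -subr_ge0.
have cos0 y : 0 <= y <= x -> cos y != 0.
  move=> /andP[y0 yx]; apply/lt0r_neq0/cos_gt0_pihalf.
  by rewrite (le_lt_trans yx xp) andbT (lt_le_trans _ y0) // oppr_lt0 divr_gt0 ?pi_gt0.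
have := @derive_ge0_le (fun y => tan y - y) (fun y => (cos y)^-2 - 1) x x0.
rewrite tan0 subrr; apply => y yx.
  by apply: is_deriveB; exact/is_derive_tan/cos0.
by rewrite cos2_tan2 ?cos0 // addrAC subrr add0r sqr_ge0.
Qed.

Lemma le_sinh x : 0 <= x -> x *+ 2 <= expR x - expR (- x).
Proof.
move=> x0; rewrite -subr_ge0.
have := @derive_ge0_le (fun y => expR y - expR (- y) - y *+ 2)
  (fun y => expR y + expR (- y) - 2) x x0.
rewrite oppr0 expR0 mul0rn subr0 subrr; apply => y _.
  apply: is_derive_eq; rewrite /GRing.scale /=; ring.
(* Halving the argument shows the derivative as the square [(e^z - e^(-z))^2]. *)
have [z ->] : exists z, y = z + z by exists (y / 2); field.
have := expRxMexpNx_1 z; rewrite opprD !expRD.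
set u := expR _; set v := expR _ => E.
have -> : u * u + v * v - 2 = (u - v) ^+ 2 + 2 * (u * v - 1) by ring.
by rewrite E subrr mulr0 addr0 sqr_ge0.
Qed.

(** Follows from [sin x <= x <= tan x] and [1/sin^2 x = 1 + 1/tan^2 x]. *)
Lemma sin_sqr_bounds x : 0 < x < pi / 2 ->
  x ^- 2 <= (sin x) ^- 2 <= 1 + x ^- 2.
Proof.
move=> /andP[x0 xp].
have s0 : 0 < sin x by apply: sin_gt0_pihalf; rewrite x0.
have c0 : 0 < cos x.
  by apply: cos_gt0_pihalf; rewrite xp andbT (lt_trans _ x0) // oppr_lt0 divr_gt0 ?pi_gt0.
apply/andP; split.
  by rewrite lef_pV2 ?posrE ?exprn_gt0 // ler_sqr ?nnegrE ?sin_le ?ltW.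
have -> : (sin x) ^- 2 = 1 + (tan x) ^- 2.
  rewrite /tan; apply: (@mulIf _ (sin x ^+ 2)); first by rewrite expf_neq0 // gt_eqF.
  rewrite mulVf ?expf_neq0 ?gt_eqF // -{1}(cos2Dsin2 x).
  field. by rewrite !gt_eqF.
have xt : x <= tan x by apply: le_tan; rewrite ltW.
have t0 : 0 < tan x by apply: lt_le_trans xt.
by rewrite lerD2l lef_pV2 ?posrE ?exprn_gt0 // ler_sqr ?nnegrE ?(ltW x0) ?(ltW t0).
Qed.

(** * Closed form for inverse squared sines, and the value of the sum of inverse squares *)

(** The cosine is written as a sine of the complementary angle so that both terms have the shape of
    the summands of [sum_sin_sqr]. *)
Lemma sin_half_sqr x : 0 < x < pi / 2 ->
  (sin (x / 2)) ^- 2 + (sin (pi / 2 - x / 2)) ^- 2 = 4 * (sin x) ^- 2.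
Proof.
move=> /andP[x0 xp].
have pp : 0 < pi :> R by exact: pi_gt0.
have s0 : sin (x / 2) != 0 by apply/lt0r_neq0/sin_gt0_pihalf; lra.
have c0 : cos (x / 2) != 0 by apply/lt0r_neq0/cos_gt0_pihalf; lra.
rewrite sinB sin_pihalf cos_pihalf mul0r subr0 mul1r.
have {3}-> : x = (x / 2) *+ 2 by rewrite mulr2n; field.
rewrite sin_mulr2n; have := cos2Dsin2 (x / 2).
set c := cos _ in c0 *; set s := sin _ in s0 * => cs1.
transitivity ((c ^+ 2 + s ^+ 2) / (c ^+ 2 * s ^+ 2)); first by field; rewrite s0 c0.
by rewrite cs1; field; rewrite s0 c0.
Qed.

(** The sum [S] satisfies [S (n+1) = 2 + 4 S n]: the middle index has angle [pi / 4] and gives 2,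
    and reflecting the upper half pairs each angle with its complement. *)
Lemma sum_sin_sqr n :
  \sum_(1 <= k < 2 ^ n) (sin (k%:R * pi / (2 ^+ n.+1))) ^- 2 =
  (4 ^+ n.+1 - 4) / 6 :> R.
Proof.
have pp : 0 < pi :> R by exact: pi_gt0.
elim: n => [|n IHn]; first by rewrite expn0 big_geq // expr1 subrr mul0r.
have two0 m : (2 : R) ^+ m != 0 by rewrite expf_neq0.
have p2 : (0 < 2 ^ n)%N by rewrite expn_gt0.
rewrite (big_cat_nat (n := 2 ^ n)) //=; last by rewrite leq_exp2l.
rewrite [X in _ + X]big_ltn; last by rewrite ltn_exp2l.
set x := _ * pi / _.
have -> : sin x ^- 2 = 2.
  have -> : x = pi / 2 / 2 by rewrite /x natrX !exprS; field.
  have := cos2Dsin2 (pi/2/2 : R).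
  have -> : cos (pi / 2 / 2) = sin (pi / 2 / 2) :> R.
    have {2}-> : pi / 2 / 2 = pi / 2 - pi / 2 / 2 :> R by field.
    by rewrite sinB sin_pihalf cos_pihalf mul0r subr0 mul1r.
  move=> E.
  have {}E : sin (pi/2/2 : R) ^+ 2 = 2^-1 by lra.
  by rewrite E invrK.
have -> : \sum_((2 ^ n).+1 <= k < 2 ^ n.+1) (sin (k%:R * pi / 2 ^+ n.+2)) ^- 2 =
  \sum_(1 <= k < 2 ^ n) (sin (pi / 2 - k%:R * pi / 2 ^+ n.+2)) ^- 2 :> R.
  rewrite -[(2 ^ n).+1]add1n big_addn expnS mul2n -addnn addnK big_nat_rev /= !big_nat.
  apply: eq_bigr => k /andP[k1 k2]; congr (sin _ ^- 2).
  rewrite add1n subSS natrD natrB; last exact: ltnW.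
  by rewrite natrX !exprS; field.
rewrite addrCA addrC -big_split /= big_nat.
rewrite (eq_bigr (fun k => 4 * (sin (k%:R * pi / 2 ^+ n.+1)) ^- 2)).
  by rewrite -big_nat -mulr_sumr IHn !exprS; field.
move=> k /andP[k1 k2].
have {}k1 : 1 <= k%:R :> R by rewrite ler1n.
have {}k2 : k%:R < 2 ^+ n :> R by rewrite -natrX ltr_nat.
rewrite -sin_half_sqr.
  by have -> : k%:R * pi / 2 ^+ n.+1 / 2 = k%:R * pi / 2 ^+ n.+2 :> R
    by rewrite !exprS; field.
rewrite divr_gt0 ?mulr_gt0 ?exprn_gt0 ?(lt_le_trans _ k1) //=.
rewrite ltr_pdivrMr ?exprn_gt0 // exprS mulrA divfK ?pnatr_eq0 // mulrC.
by rewrite ltr_pM2l.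
Qed.

Lemma sum_inv_sqr_bounds n :
  pi ^+ 2 / 6 - (pi ^+ 2 / 6 * 2 ^- n + pi ^+ 2 / 4 * 2 ^- n) <=
  \sum_(1 <= k < 2 ^ n) (k%:R : R) ^- 2 <= pi ^+ 2 / 6.
Proof.
have pp : 0 < pi :> R by exact: pi_gt0.
have two0 m : (2 : R) ^+ m != 0 by rewrite expf_neq0.
have tw : 1 <= 2 ^+ n :> R by rewrite exprn_ege1 // ler1n.
have E : \sum_(1 <= k < 2 ^ n) (k%:R : R) ^- 2 =
   pi ^+ 2 / 4 ^+ n.+1 * \sum_(1 <= k < 2 ^ n) (k%:R * pi / 2 ^+ n.+1) ^- 2.
  rewrite mulr_sumr !big_nat; apply: eq_bigr => k /andP[k1 _].
  have -> : 4 ^+ n.+1 = (2 ^+ n.+1) ^+ 2 :> R by rewrite expr2 -exprMn -natrM.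
  have kn0 : k%:R != 0 :> R by rewrite pnatr_eq0 -lt0n.
  have pn0 : pi != 0 :> R by rewrite gt_eqF.
  by move: (pi : R) pn0 => q qn0; field; rewrite two0 qn0.
have S := sum_sin_sqr n.
pose t k : R := k%:R * pi / 2 ^+ n.+1.
have B k : (1 <= k < 2 ^ n)%N -> t k ^- 2 <= (sin (t k)) ^- 2 <= 1 + t k ^- 2.
  move=> /andP[k1 k2].
  have {}k1 : 1 <= k%:R :> R by rewrite ler1n.
  have {}k2 : k%:R < 2 ^+ n :> R by rewrite -natrX ltr_nat.
  apply: sin_sqr_bounds.
  rewrite divr_gt0 ?mulr_gt0 ?exprn_gt0 ?(lt_le_trans _ k1) //=.
  rewrite ltr_pdivrMr ?exprn_gt0 // exprS mulrA divfK ?pnatr_eq0 // mulrC.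
  by rewrite ltr_pM2l.
have f4 : 4 ^+ n.+1 = 4 * 2 ^+ n * 2 ^+ n :> R.
  by rewrite exprS -mulrA -exprMn -natrM.
have U : \sum_(1 <= k < 2 ^ n) (k%:R * pi / 2 ^+ n.+1) ^- 2 <= (4 ^+ n.+1 - 4) / 6 :> R.
  by rewrite -S !big_nat; apply: ler_sum => k /B/andP[].
have L : (4 ^+ n.+1 - 4) / 6 <= 2 ^+ n + \sum_(1 <= k < 2 ^ n) (k%:R * pi / 2 ^+ n.+1) ^- 2 :> R.
  rewrite -S; apply: (@le_trans _ _ (\sum_(1 <= k < 2 ^ n) (1 + (k%:R * pi / 2 ^+ n.+1) ^- 2))).
    by rewrite !big_nat; apply: ler_sum => k /B/andP[].
  rewrite big_split /= lerD2r sumr_const_nat -natrX ler_nat leq_subr //.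
rewrite E; move: U L; set X := \sum_(1 <= k < 2 ^ n) _ => U L.
have p0 : 0 < pi ^+ 2 / 4 ^+ n.+1 :> R by rewrite divr_gt0 ?exprn_gt0.
have four0 : 4 ^+ n.+1 != 0 :> R by rewrite expf_neq0.
apply/andP; split.
  apply: (@le_trans _ _ (pi ^+ 2 / 4 ^+ n.+1 * ((4 ^+ n.+1 - 4) / 6 - 2 ^+ n))); last first.
    by rewrite ler_pM2l // lerBlDl.
  (* The exact error term [pi^2/6 * 4^(-n)] is relaxed to [pi^2/6 * 2^(-n)], so that both errors
     share one rate. *)
  rewrite f4 -subr_ge0.
  rewrite (_ : _ - _ = pi ^+ 2 / 6 * ((2 ^+ n - 1) / (2 ^+ n) ^+ 2)); last first.
    by field; exact: two0.
  by rewrite mulr_ge0 ?divr_ge0 ?sqr_ge0 ?subr_ge0.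
apply: (@le_trans _ _ (pi ^+ 2 / 4 ^+ n.+1 * ((4 ^+ n.+1) / 6))).
  by rewrite ler_pM2l // (le_trans U) // ler_pM2r ?invr_gt0 // lerBlDr lerDl.
by rewrite mulrA divfK.
Qed.

Lemma sum_inv_sqr_le n : \sum_(1 <= k < n) (k%:R : R) ^- 2 <= pi ^+ 2 / 6.
Proof.
have /andP[_] := sum_inv_sqr_bounds n; apply: le_trans.
have [n1|n1] := leqP n 1; first by rewrite big_geq // sumr_ge0.
rewrite [leRHS](big_cat_nat (n := n)) ?(ltnW n1) //=; last by rewrite ltnW // ltn_expl.
by rewrite lerDl sumr_ge0.
Qed.

Lemma sum_inv_sqr_gt e : 0 < e ->
  exists M, pi ^+ 2 / 6 - e < \sum_(1 <= k < M.+1) (k%:R : R) ^- 2.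
Proof.
move=> e0.
pose D : R := pi ^+ 2 / 6 + pi ^+ 2 / 4.
have D0 : 0 < D by rewrite addr_gt0 // divr_gt0 ?exprn_gt0 ?pi_gt0.
pose N := `|Num.ceil (D / e)|%N.
have hN : D / e < 2 ^+ N.
  rewrite (le_lt_trans (ceil_ge _)) // (le_lt_trans (ler_norm _)) //.
  by rewrite -intr_norm -natrX -[X in X%:~R]abszE ltr_nat ltn_expl.
exists (2 ^ N).-1; rewrite prednK ?expn_gt0 //; have /andP[+ _] := sum_inv_sqr_bounds N.
apply: lt_le_trans; rewrite ltrD2l ltrN2 -mulrDl -/D.
by rewrite ltr_pdivrMr ?exprn_gt0 // mulrC -ltr_pdivrMr.
Qed.

End Elementary.

(** * Effect of the recurrence on exp (c sqrt n) *)

Section Growth.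
Variable R : realType.
Implicit Types x y c : R.

(** * Truncated sums of [k e^(-k x)] *)

Lemma sum_natmul_expr y V :
  (\sum_(1 <= k < V.+1) k%:R * y ^+ k) * (1 - y) ^+ 2 =
  y * (1 - V.+1%:R * y ^+ V + V%:R * y ^+ V.+1).
Proof.
elim: V => [|V IHV]; first by rewrite big_geq // mul0r expr0 mul0r; ring.
rewrite big_nat_recr //= mulrDl IHV !exprS -(addn1 V.+1) -(addn1 V) !natrD.
by ring.
Qed.

(** With [y = e^(-x)] the sum is at most [y / (1 - y)^2 = 1 / (2 sinh (x/2))^2], and
    [2 sinh (x/2) >= x]. *)
Lemma sum_natmul_expR_le x V : 0 < x ->
  \sum_(1 <= k < V.+1) k%:R * expR (- x) ^+ k <= x ^- 2.
Proof.
move=> x0; have := sum_natmul_expr (expR (- x)) V.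
set S := \sum_(_ <= _ < _) _; set y := expR (- x) => SE.
have y0 : 0 < y by exact: expR_gt0.
have y1 : y < 1 by rewrite expR_lt1 oppr_lt0.
have S0 : 0 <= S by apply: sumr_ge0 => k _; rewrite mulr_ge0 // exprn_ge0 // ltW.
have le1 : S * (1 - y) ^+ 2 <= y.
  rewrite SE -[leRHS]mulr1 ler_pM2l // -addrA gerDl addrC subr_le0.
  apply: ler_pM => //; first by rewrite exprn_ge0 // ltW.
    by rewrite ler_nat.
  by rewrite exprS ger_pMl ?exprn_gt0 // ltW.
have le2 : x ^+ 2 * y <= (1 - y) ^+ 2.
  have [z xE] : exists z, x = z *+ 2 by exists (x / 2); rewrite mulr2n; field.
  have z0 : 0 <= z by move: x0; rewrite xE mulr2n => ?; lra.
  have := le_sinh z0; have := expRxMexpNx_1 z.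
  have -> : y = expR (- z) * expR (- z) by rewrite /y xE -expRD mulr2n opprD.
  rewrite -xE; set u := expR z; set v := expR (- z) => uv xuv.
  have v0 : 0 < v by exact: expR_gt0.
  have -> : x ^+ 2 * (v * v) = (x * v) ^+ 2 by ring.
  have xv : x * v <= 1 - v * v by rewrite -uv -mulrBl ler_pM2r.
  have xv0 : 0 < x * v by rewrite mulr_gt0.
  by rewrite ler_sqr ?nnegrE ?(ltW xv0) ?(le_trans (ltW xv0) xv).
rewrite -[leRHS]mul1r ler_pdivlMr ?exprn_gt0 // -(ler_pM2r y0) mul1r -mulrA.
by rewrite (le_trans _ le1) // ler_wpM2l.
Qed.

(** Drop the last, nonnegative term of the closed form and use [1 - e^(-x) <= x]. *)
Lemma sum_natmul_expR_ge x V : 0 < x ->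
  x ^- 2 * (expR (- x) * (1 - V.+1%:R * expR (- x) ^+ V)) <=
  \sum_(1 <= k < V.+1) k%:R * expR (- x) ^+ k.
Proof.
move=> x0; have := sum_natmul_expr (expR (- x)) V.
set S := \sum_(_ <= _ < _) _.
have S0 : 0 <= S by apply: sumr_ge0 => k _; rewrite mulr_ge0 // exprn_ge0 // expR_ge0.
have := expR_ge1Dx (- x); have : expR (- x) < 1 by rewrite expR_lt1 oppr_lt0.
have : 0 < expR (- x) by exact: expR_gt0.
move: (expR (- x)) => y y0 y1 xy SE.
rewrite mulrC ler_pdivrMr ?exprn_gt0 //.
apply: (@le_trans _ _ (S * (1 - y) ^+ 2)).
  by rewrite SE ler_pM2l // lerDl mulr_ge0 // exprn_ge0 // ltW.
rewrite ler_wpM2l // ler_sqr ?nnegrE ?subr_ge0 ?(ltW y1) ?(ltW x0) //; lra.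
Qed.

(** * Linear bounds for the square root, and their effect on the convolutions *)

Lemma sqrt_sub_le (n k : nat) : (0 < n)%N -> (k <= n)%N ->
  Num.sqrt (n - k)%:R <= Num.sqrt n%:R - k%:R / (2 * Num.sqrt n%:R) :> R.
Proof.
move=> n0 kn; rewrite natrB //.
have := @sqr_sqrtr R n%:R (ler0n _ _).
have : 0 < Num.sqrt n%:R :> R by rewrite sqrtr_gt0 ltr0n.
move: (Num.sqrt n%:R) => t t0 tE.
have kt : k%:R <= t ^+ 2 by rewrite tE ler_nat.
have k0 : 0 <= k%:R :> R by [].
have tn0 : t != 0 by rewrite gt_eqF.
have B0 : 0 <= t - k%:R / (2 * t).
  rewrite subr_ge0 ler_pdivrMr ?mulr_gt0 //; nra.
rewrite -[leRHS]ger0_norm // -sqrtr_sqr; apply: ler_wsqrtr; rewrite -tE -subr_ge0.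
have -> : (t - k%:R / (2 * t)) ^+ 2 - (t ^+ 2 - k%:R) = (k%:R / (2 * t)) ^+ 2.
  by field; rewrite tn0.
exact: sqr_ge0.
Qed.

(** A converse to the tangent bound: steepening the slope by [1 + 1/q] pays for the curvature as
    long as [k <= n / q]. After squaring, what remains is [(1 + w)^2 k <= 4 w n] with
    [w = 1/q <= 1]. *)
Lemma sqrt_sub_ge (q n k : nat) : (0 < q)%N -> (0 < n)%N -> (q * k <= n)%N ->
  Num.sqrt n%:R - (1 + q%:R^-1) * k%:R / (2 * Num.sqrt n%:R) <=
  Num.sqrt (n - k)%:R :> R.
Proof.
move=> q0 n0 qkn.
have kn : (k <= n)%N by rewrite (leq_trans _ qkn) // leq_pmull.
rewrite natrB //.
have := @sqr_sqrtr R n%:R (ler0n _ _).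
have : 0 < Num.sqrt n%:R :> R by rewrite sqrtr_gt0 ltr0n.
move: (Num.sqrt n%:R) => t t0 tE.
have th0 : 0 < q%:R^-1 :> R by rewrite invr_gt0 ltr0n.
have th1 : q%:R^-1 <= 1 :> R by rewrite invf_le1 ?ler1n ?ltr0n.
have kt : k%:R <= q%:R^-1 * t ^+ 2.
  by rewrite tE ler_pdivlMl ?ltr0n // -natrM ler_nat.
have k0 : 0 <= k%:R :> R by [].
have tn0 : t != 0 by rewrite gt_eqF.
move: (q%:R^-1) th0 th1 kt => w w0 w1 kt.
have [B0|/ltW B0] := leP 0 (t - (1 + w) * k%:R / (2 * t)); last first.
  by rewrite (le_trans B0) // sqrtr_ge0.
rewrite -[leLHS]ger0_norm // -sqrtr_sqr; apply: ler_wsqrtr; rewrite -tE -subr_ge0.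
have -> : (t ^+ 2 - k%:R) - (t - (1 + w) * k%:R / (2 * t)) ^+ 2 =
  (4 * (w * t ^+ 2) - (1 + w) ^+ 2 * k%:R) * (k%:R / (4 * t ^+ 2)).
  by field; rewrite tn0.
apply: mulr_ge0; last (apply: divr_ge0 => //; apply: mulr_ge0 => //; exact: sqr_ge0).
rewrite subr_ge0.
apply: ler_pM => //; first exact: sqr_ge0.
nra.
Qed.

(** For fixed [m] the tangent bound turns the sum over [k] into [d e^(c sqrt n)] times a sum of
    [k e^(-k x)] with [x = c d m / (2 sqrt n)], which is at most [x^(-2)]. *)
Lemma divisor_conv_le d n c (a : nat -> R) : (0 < d)%N -> (0 < n)%N -> 0 < c ->
  (forall j, (j < n)%N -> a j <= expR (c * Num.sqrt j%:R)) ->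
  divisor_conv d a n <= expR (c * Num.sqrt n%:R) * n%:R *
    (4 / (c ^+ 2 * d%:R)) * \sum_(1 <= m < n.+1) (m%:R : R) ^- 2.
Proof.
move=> d0 n0 c0 aub; rewrite mulr_sumr; apply: ler_sum_nat => m /andP[m1 _].
have tE := @sqr_sqrtr R n%:R (ler0n _ _).
have t0 : 0 < Num.sqrt n%:R :> R by rewrite sqrtr_gt0 ltr0n.
have m0 : 0 < m%:R :> R by rewrite ltr0n.
have d0' : 0 < d%:R :> R by rewrite ltr0n.
pose x := c * d%:R * m%:R / (2 * Num.sqrt n%:R).
have x0 : 0 < x by rewrite !(divr_gt0, mulr_gt0).
apply: (@le_trans _ _ (\sum_(1 <= k < n.+1) d%:R * expR (c * Num.sqrt n%:R) *
   (k%:R * expR (- x) ^+ k))).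
  apply: ler_sum_nat => k /andP[k1 _]; case: ifP => [dkm|_]; last first.
    by rewrite !mulr_ge0 ?expR_ge0 ?exprn_ge0 ?expR_ge0.
  rewrite natrM -mulrA -mulrA ler_pM2l // mulrCA ler_pM2l ?ltr0n //.
  have lt : (n - d * k * m < n)%N by rewrite ltn_subrL n0 !muln_gt0 d0 k1 m1.
  apply: (le_trans (aub _ lt)); rewrite -expRM_natl -expRD ler_expR.
  apply: (le_trans (ler_wpM2l (ltW c0) (sqrt_sub_le n0 dkm))).
  rewrite le_eqVlt; apply/orP; left; apply/eqP.
  by rewrite /x !natrM; field; rewrite gt_eqF.
rewrite -mulr_sumr.
apply: (le_trans (ler_wpM2l _ (sum_natmul_expR_le n x0))).
  by rewrite mulr_ge0 // expR_ge0.
rewrite le_eqVlt; apply/orP; left; apply/eqP.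
rewrite /x; move: (expR _) => E; rewrite -[in RHS]tE; field.
by rewrite !gt_eqF.
Qed.

Lemma sqrt_nat_large (K : R) :
  exists n0, forall n, (n0 <= n)%N -> K <= Num.sqrt n%:R.
Proof.
exists `|Num.ceil (K ^+ 2)|%N => n n0n.
rewrite (le_trans (ler_norm _)) // -sqrtr_sqr; apply: ler_wsqrtr.
rewrite (le_trans (ceil_ge _)) // (le_trans (ler_norm _)) //.
by rewrite -intr_norm -[X in X%:~R]abszE ler_nat.
Qed.

(** Uniformly in [m <= M], [x] tends to 0 while [(n %/ w) * x] grows at least like [sqrt n]. So both
    factors are eventually at least [1 - e/2] with [e = 1/q], and their product is at least
    [1 - e]. *)
Lemma truncation_negligible (b : R) (q w M : nat) : 0 < b -> (0 < q)%N -> (0 < w)%N ->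
  exists n0, forall n, (n0 <= n)%N -> forall m x, (1 <= m < M.+1)%N ->
  x = b * m%:R / Num.sqrt n%:R ->
  1 - q%:R^-1 <= expR (- x) * (1 - (n %/ w).+1%:R * expR (- x) ^+ (n %/ w)).
Proof.
move=> b0 q0 w0.
have th0 : 0 < q%:R^-1 :> R by rewrite invr_gt0 ltr0n.
have th1 : q%:R^-1 <= 1 :> R by rewrite invf_le1 ?ler1n ?ltr0n.
move: (q%:R^-1) th0 th1 => e e0 e1 {q q0}.
have [n1 H1] := sqrt_nat_large (2 * b * M%:R / e).
have [n2 H2] := sqrt_nat_large (96 * w%:R ^+ 2 / (b ^+ 3 * e)).
exists (maxn w (maxn n1 n2)) => n; rewrite !geq_max => /and3P[wn /H1 {}H1 /H2 {}H2] m x.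
move=> /andP[m1 mM] xE; set V := (n %/ w)%N.
have n0 : (0 < n)%N by apply: leq_trans wn.
have tE := @sqr_sqrtr R n%:R (ler0n _ _).
have t0 : 0 < Num.sqrt n%:R :> R by rewrite sqrtr_gt0 ltr0n.
have V1 : (1 <= V)%N by rewrite divn_gt0.
have nV : n%:R <= 2 * V%:R * w%:R :> R.
  rewrite -!natrM ler_nat {1}(divn_eq n w) -/V.
  have : (n %% w <= w)%N by rewrite ltnW // ltn_pmod.
  have : (w <= V * w)%N by rewrite leq_pmull.
  lia.
have x0 : 0 < x by rewrite xE divr_gt0 ?mulr_gt0 ?ltr0n.
move: tE t0 H1 H2 xE; move: (Num.sqrt n%:R) => t tE t0 H1 H2 xE.
have ex : 1 - e / 2 <= expR (- x).
  apply: (le_trans _ (expR_ge1Dx _)); rewrite lerD2l lerN2.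
  rewrite xE ler_pdivrMr // (@le_trans _ _ (b * M%:R)) ?ler_pM2l ?ler_nat //.
  move: H1; rewrite ler_pdivrMr //; lra.
have tail : V.+1%:R * expR (- x) ^+ V <= e / 2.
  pose z := b * V%:R / t.
  have V0 : 0 < V%:R :> R by rewrite ltr0n.
  have z0 : 0 < z by rewrite divr_gt0 ?mulr_gt0.
  (* A cubic bound suffices: [V] has order [t^2] and [z] order [t], so [V / z^3] has order [1/t]. *)
  have ez : z ^+ 3 / 6 <= expR z.
    by apply: le_trans (expR_ge1Dxn 2 (ltW z0)); rewrite lerDr.
  have le1 : expR (- x) ^+ V <= 6 / z ^+ 3.
    apply: (@le_trans _ _ (expR (- z))).
      rewrite -expRM_natl ler_expR mulrN lerN2 /z xE !mulrA ler_pM2r ?invr_gt0 //.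
      by rewrite (mulrC b) ler_peMr ?ler1n // mulr_ge0 // ltW.
    by rewrite expRN -[6 / _]invf_div lef_pV2 ?posrE ?expR_gt0 ?divr_gt0 ?exprn_gt0.
  have VS : V.+1%:R <= 2 * V%:R :> R by rewrite -natrM ler_nat; lia.
  apply: (le_trans (ler_pM _ _ VS le1)) => //.
  have -> : 2 * V%:R * (6 / z ^+ 3) = 12 * t ^+ 3 / (b ^+ 3 * V%:R ^+ 2).
    by rewrite /z; field; rewrite !gt_eqF.
  rewrite ler_pdivrMr ?mulr_gt0 ?exprn_gt0 //.
  move: H2; rewrite ler_pdivrMr ?mulr_gt0 ?exprn_gt0 // => H2.
  rewrite -tE in nV.
  have sq : t ^+ 4 <= 4 * V%:R ^+ 2 * w%:R ^+ 2.
    have -> : t ^+ 4 = (t ^+ 2) ^+ 2 by ring.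
    have -> : 4 * V%:R ^+ 2 * w%:R ^+ 2 = (2 * V%:R * w%:R) ^+ 2 :> R by ring.
    by rewrite ler_sqr ?nnegrE ?sqr_ge0 ?mulr_ge0.
  rewrite -(ler_pM2r t0).
  apply: (@le_trans _ _ (48 * V%:R ^+ 2 * w%:R ^+ 2)).
    have -> : 12 * t ^+ 3 * t = 12 * t ^+ 4 by ring.
    lra.
  have := ler_wpM2l (sqr_ge0 (V%:R : R)) H2; lra.
have -> : 1 - e = (1 - e / 2) * (1 - e / 2) - (e / 2) ^+ 2 by field.
apply: (@le_trans _ _ ((1 - e / 2) * (1 - e / 2))).
  by rewrite gerDl oppr_le0 sqr_ge0.
apply: ler_pM => //; lra.
Qed.

(** All terms are nonnegative, so only [m <= M] and [k <= n %/ w] are kept. The threshold [n0]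
    precedes [a] and [delta] in the quantifiers, which lets [delta] be chosen after it. *)
Lemma divisor_conv_ge c (q M d : nat) : 0 < c -> (0 < q)%N -> (0 < d)%N ->
  exists n0, forall n, (n0 <= n)%N -> forall (a : nat -> R) delta, 0 < delta ->
  (forall j, 0 <= a j) ->
  (forall j, (j < n)%N -> delta * expR (c * Num.sqrt j%:R) <= a j) ->
  delta * expR (c * Num.sqrt n%:R) * n%:R *
    ((1 - q%:R^-1) / (1 + q%:R^-1) ^+ 2 * (4 / (c ^+ 2 * d%:R))) *
    \sum_(1 <= m < M.+1) (m%:R : R) ^- 2 <= divisor_conv d a n.
Proof.
(* With this [w], [k <= n %/ w] and [m <= M] force [q * (d * k * m) <= n], as [sqrt_sub_ge]
   requires. *)
move=> c0 q0 d0; pose w := (q * d * M.+1)%N.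
have w0 : (0 < w)%N by rewrite !muln_gt0 q0 d0.
have th0 : 0 < q%:R^-1 :> R by rewrite invr_gt0 ltr0n.
have d0' : 0 < d%:R :> R by rewrite ltr0n.
pose b := c * (1 + q%:R^-1) * d%:R / 2.
have b0 : 0 < b by rewrite divr_gt0 ?mulr_gt0 ?addr_gt0.
have [n1 H1] := @truncation_negligible b q w M b0 q0 w0.
exists (maxn n1 M.+1) => n; rewrite geq_max => /andP[/H1 {}H1 Mn] a delta dl0 a0 alb.
have n0 : (0 < n)%N by apply: leq_trans Mn.
have tE := @sqr_sqrtr R n%:R (ler0n _ _).
have t0 : 0 < Num.sqrt n%:R :> R by rewrite sqrtr_gt0 ltr0n.
rewrite /divisor_conv [leRHS](big_cat_nat (n := M.+1)) ?(leqW Mn) //=.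
apply: ler_wpDr.
  apply: sumr_ge0 => m _; apply: sumr_ge0 => k _; case: ifP => // _.
  by rewrite mulr_ge0.
rewrite mulr_sumr; apply: ler_sum_nat => m mM.
have H := H1 m _ mM erefl; case/andP: mM => m1 mM.
have m0 : 0 < m%:R :> R by rewrite ltr0n.
set x := b * m%:R / Num.sqrt n%:R in H; set V := (n %/ w)%N in H.
have x0 : 0 < x by rewrite divr_gt0 ?mulr_gt0.
have Vn : (V <= n)%N by exact: leq_div.
rewrite [leRHS](big_cat_nat (n := V.+1)) ?ltnS //=; apply: ler_wpDr.
  by apply: sumr_ge0 => k _; case: ifP => // _; rewrite mulr_ge0.
apply: (@le_trans _ _ (\sum_(1 <= k < V.+1) d%:R * (delta * expR (c * Num.sqrt n%:R)) *
   (k%:R * expR (- x) ^+ k))); last first.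
  apply: ler_sum_nat => k /andP[k1 kV].
  have qn : (q * (d * k * m) <= n)%N.
    apply: leq_trans (leq_trunc_div n w); rewrite -/V /w.
    have -> : (q * (d * k * m) = k * (q * d * m))%N by lia.
    by rewrite leq_mul // leq_mul // ltnW.
  have dn : (d * k * m <= n)%N by rewrite (leq_trans _ qn) // leq_pmull.
  rewrite dn natrM -[leLHS]mulrA -[leRHS]mulrA ler_pM2l // mulrCA ler_pM2l ?ltr0n //.
  have lt : (n - d * k * m < n)%N by rewrite ltn_subrL n0 !muln_gt0 d0 k1 m1.
  apply: le_trans (alb _ lt); rewrite -mulrA ler_pM2l // -expRM_natl -expRD ler_expR.
  apply: (le_trans _ (ler_wpM2l (ltW c0) (sqrt_sub_ge q0 n0 qn))).
  rewrite le_eqVlt; apply/orP; left; apply/eqP.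
  rewrite /x /b !natrM; move: (q%:R^-1) => e.
  by field; rewrite gt_eqF.
rewrite -mulr_sumr.
apply: (le_trans _ (ler_wpM2l _ (sum_natmul_expR_ge V x0))); last first.
  by rewrite !mulr_ge0 ?expR_ge0 ?(ltW dl0).
apply: (le_trans _ (ler_wpM2l _ (ler_wpM2l _ H))); last 2 first.
- by rewrite !mulr_ge0 ?expR_ge0 ?(ltW dl0).
- by rewrite invr_ge0 sqr_ge0.
rewrite le_eqVlt; apply/orP; left; apply/eqP.
rewrite /x /b; move: (q%:R^-1) th0 => e e0.
move: (expR _) => E; rewrite -[in LHS]tE; field.
by rewrite !gt_eqF ?addr_gt0.
Qed.

(** * Limits for the lower-order terms *)

Lemma cvg_inv_sqrt : (Num.sqrt n%:R)^-1 @[n --> \oo] --> (0 : R).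
Proof.
apply/cvgrPdist_le => e e0; have [n0 H] := sqrt_nat_large (e^-1).
near=> n; rewrite sub0r normrN ger0_norm ?invr_ge0 ?sqrtr_ge0 //.
have eV : 0 < e^-1 by rewrite invr_gt0.
have le : e^-1 <= Num.sqrt n%:R by apply: H; near: n; exact: nbhs_infty_ge.
by rewrite -[leRHS]invrK lef_pV2 ?posrE ?(lt_le_trans eV le).
Unshelve. all: by end_near. Qed.

(** With [u = n^(1/4)], [ln n = 4 ln u <= 4 u] and [sqrt n = u^2], so the quotient is at most
    [4 / u]. *)
Lemma cvg_ln_div_sqrt : ln n%:R / Num.sqrt n%:R @[n --> \oo] --> (0 : R).
Proof.
apply/cvgrPdist_le => e e0; have [n0 H] := sqrt_nat_large ((4 / e) ^+ 2).
near=> n.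
have n1 : (0 < n)%N by near: n; exact: nbhs_infty_gt.
have {}H : (4 / e) ^+ 2 <= Num.sqrt n%:R by apply: H; near: n; exact: nbhs_infty_ge.
have n1R : 1 <= n%:R :> R by rewrite ler1n.
have t0 : 0 < Num.sqrt n%:R :> R by rewrite sqrtr_gt0 ltr0n.
rewrite sub0r normrN ger0_norm ?divr_ge0 ?ln_ge0 ?(ltW t0) //.
have u0 : 0 < Num.sqrt (Num.sqrt n%:R) :> R by rewrite sqrtr_gt0.
have tE := sqr_sqrtr (ltW t0); have nE := @sqr_sqrtr R n%:R (ler0n _ _).
have lnE : ln n%:R = ln (Num.sqrt (Num.sqrt n%:R)) *+ 4 :> R.
  by rewrite -lnXn // -[4%N]/(2 * 2)%N exprM tE nE.
have Hu : 4 / e <= Num.sqrt (Num.sqrt n%:R).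
  by rewrite -ler_sqr ?nnegrE ?divr_ge0 ?(ltW e0) ?(ltW u0) // tE.
rewrite lnE -[X in _ / X]tE; move: (Num.sqrt (Num.sqrt _)) u0 Hu => u u0 Hu.
rewrite ler_pdivrMr ?exprn_gt0 //; have := ln_sublinear u0.
move: Hu; rewrite ler_pdivrMr // => Hu lu.
apply: (@le_trans _ _ (4 * u)); last by have := ler_wpM2r (ltW u0) Hu; lra.
by rewrite -[leLHS]mulr_natl ler_pM2l // ltW.
Unshelve. all: by end_near. Qed.

End Growth.

(** * Growth of the coefficients *)

Section TwoColorGrowth.
Variables (R : realType) (r : nat) (a : nat -> R).
Hypotheses (r_gt0 : (0 < r)%N) (a_gf : two_color_gf r a).

Let C : R := pi * Num.sqrt (2 * (1 + r%:R^-1) / 3).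

Let rV_gt0 : 0 < r%:R^-1 :> R. Proof. by rewrite invr_gt0 ltr0n. Qed.

Let C_gt0 : 0 < C.
Proof. by rewrite mulr_gt0 ?pi_gt0 // sqrtr_gt0 divr_gt0 // mulr_gt0 // addr_gt0. Qed.

Let C_sqr : C ^+ 2 = 4 * (1 + r%:R^-1) * (pi ^+ 2 / 6).
Proof.
rewrite exprMn sqr_sqrtr; last by rewrite divr_ge0 // mulr_ge0 // addr_ge0 ?(ltW rV_gt0).
by move: (pi : R) (r%:R^-1 : R) => p w; field.
Qed.

Lemma two_color0 : a 0%N = 1.
Proof.
have [N /(_ N (leqnn _)) <-] := a_gf 0%N.
elim: N => [|N IHN] //=; rewrite /fpsM big_ord1 subnn IHN mul1r.
rewrite /two_color_factor /fps_inv /= /fps_of_poly coef0M !coefB coef1 !coefXn.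
have rN : (0 < r * N.+1)%N by rewrite muln_gt0 r_gt0.
by rewrite (ltn_eqF rN) !subr0 mulr1 invr1.
Qed.

Lemma divisor_conv_ge0 d n : (forall j, (j < n)%N -> 0 <= a j) -> (0 < d)%N ->
  0 <= divisor_conv d a n.
Proof.
move=> a0 d0; rewrite /divisor_conv !big_nat; apply: sumr_ge0 => m /andP[m1 mn].
rewrite big_nat; apply: sumr_ge0 => k /andP[k1 _]; case: ifP => // _.
by rewrite mulr_ge0 // a0 // ltn_subrL !muln_gt0 d0 k1 m1 (leq_trans m1).
Qed.

Lemma two_color_gt0 n : 0 < a n.
Proof.
have [m] := ubnP n; elim: m n => // m IHm [|n] nm; first by rewrite two_color0.
have an : 0 < n.+1%:R :> R by rewrite ltr0n.
have a0 j : (j < n.+1)%N -> 0 <= a j by move=> jn; apply/ltW/IHm; rewrite (leq_trans jn).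
rewrite -(pmulr_rgt0 _ an) (two_color_rec _ r_gt0 a_gf).
apply: ltr_pwDl; last exact: divisor_conv_ge0.
(* The term [k = m = 1] is the preceding coefficient, positive by induction; the others are
   nonnegative. *)
rewrite /divisor_conv big_ltn // [X in X + _]big_ltn //= !muln1 mul1r subSS subn0.
rewrite -addrA ltr_pwDl ?IHm //.
rewrite addr_ge0 //.
  rewrite big_nat; apply: sumr_ge0 => k /andP[k1 _]; case: ifP => // _.
  by rewrite mulr_ge0 // a0 // ltn_subrL !muln_gt0 (leq_trans _ k1).
rewrite big_nat; apply: sumr_ge0 => i /andP[i1 _].
rewrite big_nat; apply: sumr_ge0 => k /andP[k1 _]; case: ifP => // _.
by rewrite mulr_ge0 // a0 // ltn_subrL !muln_gt0 k1 (leq_trans _ i1).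
Qed.

(** Strong induction from [a 0 = 1 = e^0]. By [C_sqr] the two convolution bounds add up to
    [n e^(C sqrt n) * S / P] with [P = pi^2/6] and [S <= P] a partial sum of inverse squares. *)
Lemma two_color_le n : a n <= expR (C * Num.sqrt n%:R).
Proof.
have [m] := ubnP n; elim: m n => // m IHm [|n] nm.
  by rewrite two_color0 sqrtr0 mulr0 expR0.
have an : 0 < n.+1%:R :> R by rewrite ltr0n.
have aub j : (j < n.+1)%N -> a j <= expR (C * Num.sqrt j%:R).
  by move=> jn; apply: IHm; rewrite (leq_trans jn).
rewrite -(ler_pM2l an) (two_color_rec _ r_gt0 a_gf).
apply: (le_trans (lerD (divisor_conv_le (ltn0Sn 0) (ltn0Sn n) C_gt0 aub)
  (divisor_conv_le r_gt0 (ltn0Sn n) C_gt0 aub))).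
rewrite C_sqr; have := sum_inv_sqr_le R n.+2.
set S := \sum_(_ <= _ < _) _; move: (expR _) (expR_gt0 (C * Num.sqrt n.+1%:R)) => E E0 SP.
have P0 : 0 < pi ^+ 2 / 6 :> R by rewrite divr_gt0 // exprn_gt0 // pi_gt0.
move: (pi ^+ 2 / 6) SP P0 => P SP P0.
have r0 : 0 < r%:R :> R by rewrite ltr0n.
rewrite [leLHS](_ : _ = n.+1%:R * E * (S / P)); last first.
  by field; rewrite !gt_eqF // addr_gt0.
by rewrite -[leRHS]mulr1 ler_pM2l ?mulr_gt0 // ler_pdivrMr // mul1r.
Qed.

(** The gap between [c] and [C] pays for cutting the sum of inverse squares at [M] and for the loss
    in [q]. The induction starts at a threshold [n0], and [delta] covers the indices below it. *)
Lemma two_color_ge c : 0 < c < C ->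
  exists2 delta, 0 < delta & forall n, delta * expR (c * Num.sqrt n%:R) <= a n.
Proof.
move=> /andP[c0 cC].
have cC2 : c ^+ 2 < C ^+ 2 by rewrite ltr_sqr ?nnegrE ?(ltW c0) ?(ltW C_gt0).
pose D : R := 4 * (1 + r%:R^-1).
have D0 : 0 < D by rewrite mulr_gt0 // addr_gt0.
have e0 : 0 < pi ^+ 2 / 6 - c ^+ 2 / D.
  by rewrite subr_gt0 ltr_pdivrMr // mulrC -C_sqr.
have [M] := sum_inv_sqr_gt e0; rewrite subKr.
set S := \sum_(_ <= _ < _) _ => SM.
have S0 : 0 < S by apply: le_lt_trans SM; rewrite divr_ge0 ?sqr_ge0 ?ltW.
(* The loss in [q] may bring its factor down to [rho]; the choice of [M] made [S > c^2 / D], hence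
   [rho < 1]. *)
pose rho := c ^+ 2 / (D * S).
have rho1 : rho < 1.
  by rewrite ltr_pdivrMr ?mulr_gt0 // mul1r mulrC -ltr_pdivrMr.
pose q := `|Num.ceil (3 / (1 - rho))|.+1%N.
have q0 : (0 < q)%N by [].
have qr : q%:R^-1 <= (1 - rho) / 3 :> R.
  rewrite -[leRHS]invf_div lef_pV2 ?posrE ?ltr0n ?divr_gt0 ?subr_gt0 //.
  rewrite (le_trans (ceil_ge _)) // (le_trans (ler_norm _)) //.
  by rewrite -intr_norm -[X in X%:~R]abszE ler_nat.
have qV0 : 0 < q%:R^-1 :> R by rewrite invr_gt0 ltr0n.
have key : rho <= (1 - q%:R^-1) / (1 + q%:R^-1) ^+ 2.
  move: (q%:R^-1 : R) qV0 qr => e e0' er.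
  rewrite ler_pdivlMr ?exprn_gt0 ?addr_gt0 //.
  (* The 3 in the choice of [q] gives [rho <= 1 - 3 e], and [(1 - 3 e) (1 + e)^2 <= 1 - e]. *)
  apply: (@le_trans _ _ ((1 - 3 * e) * (1 + e) ^+ 2)).
    by rewrite ler_wpM2r ?sqr_ge0 //; lra.
  rewrite -subr_ge0.
  have -> : 1 - e - (1 - 3 * e) * (1 + e) ^+ 2 = e * (5 * e + 3 * e ^+ 2) by ring.
  by rewrite mulr_ge0 ?addr_ge0 ?mulr_ge0 ?sqr_ge0 ?(ltW e0').
have [n1 H1] := divisor_conv_ge M c0 q0 (ltn0Sn 0).
have [n2 H2] := divisor_conv_ge M c0 q0 r_gt0.
pose n0 := maxn n1 (maxn n2 1).
(* A minimum of finitely many ratios, positive because every [a m] is. *)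
have [delta d0 Hd] : exists2 delta, 0 < delta &
    forall j, (j < n0)%N -> delta * expR (c * Num.sqrt j%:R) <= a j.
  elim: n0 => [|m [delta d0 Hd]]; first by exists 1.
  pose d := a m / expR (c * Num.sqrt m%:R).
  have dd0 : 0 < d by rewrite divr_gt0 ?two_color_gt0 ?expR_gt0.
  exists (Num.min delta d); first by rewrite lt_min d0.
  move=> j; rewrite ltnS leq_eqVlt => /predU1P[->|jm].
    by rewrite -ler_pdivlMr ?expR_gt0 // ge_min lexx orbT.
  apply: le_trans (Hd j jm); rewrite ler_pM2r ?expR_gt0 //.
  by rewrite ge_min lexx.
exists delta => // n.
have [m] := ubnP n; elim: m n => // m IHm n nm.
have [|nn] := ltnP n n0; first exact: Hd.
move: nn; rewrite !geq_max => /and3P[/H1 {}H1 /H2 {}H2 n_gt0].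
have an : 0 < n%:R :> R by rewrite ltr0n.
have a0 j : 0 <= a j by rewrite ltW // two_color_gt0.
have alb j : (j < n)%N -> delta * expR (c * Num.sqrt j%:R) <= a j.
  by move=> jn; apply: IHm; rewrite (leq_trans jn).
rewrite -(ler_pM2l an) (two_color_rec _ r_gt0 a_gf).
apply: (le_trans _ (lerD (H1 a delta d0 a0 alb) (H2 a delta d0 a0 alb))).
rewrite -/S; move: key; move: (_ / (1 + _) ^+ 2) => t key.
move: (expR _) (expR_gt0 (c * Num.sqrt n%:R)) => E E0.
have r0 : 0 < r%:R :> R by rewrite ltr0n.
rewrite [leRHS](_ : _ = n%:R * (delta * E) * (t / rho)); last first.
  by rewrite /rho /D; field; rewrite !gt_eqF // addr_gt0.
have rho0 : 0 < rho by rewrite divr_gt0 ?exprn_gt0 ?mulr_gt0.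
by rewrite -[leLHS]mulr1 ler_pM2l ?mulr_gt0 // ler_pdivlMr // mul1r.
Qed.

Lemma cvg_ln_two_color : ln (a n) / Num.sqrt n%:R @[n --> \oo] --> C.
Proof.
apply/cvgrPdist_le => e e0.
(* Within [e/2] of [C] and still positive; the other [e/2] absorbs [ln delta / sqrt n]. *)
pose c := Num.max (C / 2) (C - e / 2).
have cP : 0 < c < C.
  rewrite lt_max gt_max divr_gt0 //=; have := C_gt0; lra.
have [delta d0 Hd] := two_color_ge cP.
have [n0 H] := sqrt_nat_large (2 * `|ln delta| / e).
near=> n.
have n1 : (0 < n)%N by near: n; exact: nbhs_infty_gt.
have {}H : 2 * `|ln delta| / e <= Num.sqrt n%:R by apply: H; near: n; exact: nbhs_infty_ge.
have t0 : 0 < Num.sqrt n%:R :> R by rewrite sqrtr_gt0 ltr0n.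
have up : ln (a n) <= C * Num.sqrt n%:R.
  by rewrite -[leRHS]expRK ler_ln ?posrE ?two_color_gt0 ?expR_gt0 // two_color_le.
have lo : ln delta + c * Num.sqrt n%:R <= ln (a n).
  rewrite -[X in _ + X]expRK -lnM ?posrE ?expR_gt0 //.
  by rewrite ler_ln ?posrE ?two_color_gt0 ?mulr_gt0 ?expR_gt0.
have cC : C - e / 2 <= c by rewrite le_max lexx orbT.
move: (Num.sqrt _) H t0 up lo => t H t0 up lo.
rewrite ger0_norm; last by rewrite subr_ge0 ler_pdivrMr.
rewrite lerBlDr -lerBlDl ler_pdivlMr //.
apply: le_trans lo; move: H; rewrite ler_pdivrMr // => H.
have := lerNnormlW (lexx `|ln delta|).
have := ler_wpM2r (ltW t0) cC; lra.
Unshelve. all: by end_near. Qed.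

End TwoColorGrowth.

(** * Comparison with the stated expansion *)

Theorem theorem1p1 (R : realType) (r : nat) (r_gt0 : (0 < r)%N)
    (a : nat -> R) (a_gf : two_color_gf r a) :
  asymp_equiv
    (fun n : nat => ln (a n))
    (fun n : nat =>
       pi * Num.sqrt (2 * n%:R * (1 + r%:R^-1) / 3)
       - 5 / 4 * ln n%:R
       + ln (2 * Num.sqrt (3 * r%:R) * (1 + r%:R^-1) `^ (3 / 4) / 24 `^ (5 / 4))
       - c_ R r / (24 * Num.sqrt (6 * n%:R))).
Proof.
rewrite /asymp_equiv; set L := ln (2 * _ * _ / _); set c := c_ R r.
have := cvg_ln_two_color r_gt0 a_gf; set C : R := pi * _ => fC.
have r0 : 0 < r%:R^-1 :> R by rewrite invr_gt0 ltr0n.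
have C0 : C != 0.
  by rewrite gt_eqF // mulr_gt0 ?pi_gt0 // sqrtr_gt0 divr_gt0 // mulr_gt0 // addr_gt0.
pose h n : R := (Num.sqrt n%:R)^-1.
have h0 : h @ \oo --> (0 : R) by exact: cvg_inv_sqrt.
(* The right-hand side divided by [sqrt n]: every term but [C] vanishes in the limit. *)
pose G n : R := C - 5 / 4 * (ln n%:R / Num.sqrt n%:R) + L * h n
  - c / (24 * Num.sqrt 6) * (h n * h n).
have GC : G @ \oo --> C.
  have E : C = C - 5 / 4 * 0 + L * 0 - c / (24 * Num.sqrt 6) * (0 * 0).
    by rewrite !mulr0 !subr0 addr0.
  rewrite [X in _ --> X]E.
  apply: cvgB; last by apply: cvgMr; apply: cvgM.
  apply: cvgD; last exact: cvgMr.
  apply: cvgB; first exact: cvg_cst.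
  by apply: cvgMr; exact: cvg_ln_div_sqrt.
rewrite -[X in _ --> X](divff C0).
(* For [n > 0] the factors [sqrt n] cancel and the quotient is [(ln (a n) / sqrt n) / G n], with
   limit [C / C]. *)
apply: cvg_trans (cvgM fC (cvgV C0 GC)); apply: near_eq_cvg.
near=> n.
have n1 : (0 < n)%N by near: n; exact: nbhs_infty_gt.
have t0 : 0 < Num.sqrt n%:R :> R by rewrite sqrtr_gt0 ltr0n.
have s6 : 0 < Num.sqrt 6 :> R by rewrite sqrtr_gt0.
have CE : pi * Num.sqrt (2 * n%:R * (1 + r%:R^-1) / 3) = C * Num.sqrt n%:R.
  rewrite /C -[RHS]mulrA -sqrtrM; last by rewrite divr_ge0 // mulr_ge0 // addr_ge0 // ltW.
  by congr (_ * Num.sqrt _); ring.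
rewrite /= CE (sqrtrM n%:R (ler0n _ 6)).
have -> : (C * Num.sqrt n%:R - 5 / 4 * ln n%:R + L
    - c / (24 * (Num.sqrt 6 * Num.sqrt n%:R))) = G n * Num.sqrt n%:R.
  by rewrite /G /h; field; rewrite !gt_eqF.
by rewrite invfM mulrA mulrAC.
Unshelve. all: by end_near. Qed.
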